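(* Let $(S,T,r,p,l)$ be an instance in which all terminal coordinates $p(t)$ ($t\in T$) are integral and all length restrictions $l_t$ are integers. If $\pi$ is a feasible embedding, then there exists a feasible half-integral embedding $\sigma$ with $\max_{v\in V(S)}\|\pi(v)-\sigma(v)\|_\infty\le 1/2$ and $c(\sigma)\le c(\pi)$.
   Context: An instance $(S,T,r,p,l)$ consists of a finite tree $S$, terminals $T\subseteq V(S)$, a root $r\in T$ with $p(r)=(0,0)$, positions $p:T\to\mathbb{R}^2$, and length restrictions $l_t\in\mathbb{R}_{\ge0}$ for $t\in T$. An embedding is a map $\pi:V(S)\to\mathbb{R}^2$ with $\pi(t)=p(t)$ for $t\in T$. For $t\in T$, $d_\pi(t)$ is the sum of $\|\pi(v)-\pi(w)\|_1$ over the edges $\{v,w\}$ of the unique $r$–$t$ path in $S$; the cost is $c(\pi)=\sum_{\{v,w\}\in E(S)}\|\pi(v)-\pi(w)\|_1$. An embedding is feasible if $d_\pi(t)\le l_t$ for all $t\in T$. An embedding is half-integral if all coordinates of all $\pi(v)$, $v\in V(S)$, lie in $\frac12\mathbb{Z}$. *)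

(* Defs.v *)
From HB Require Import structures.
From mathcomp Require Import all_boot all_order all_algebra.
From mathcomp Require Import reals normedtype.
Set Implicit Arguments.
Unset Strict Implicit.
Unset Printing Implicit Defensive.
Import Order.TTheory GRing.Theory Num.Theory.
Local Open Scope ring_scope.

(* Acyclicity is stated through [ucycle], which also accepts the two-vertex
   sequences [:: x; y] running back and forth along one edge; genuine graph
   cycles are those with at least three vertices. *)
Record tree := Tree {
  vertex :> finType;
  adj : rel vertex;
  adj_sym : symmetric adj;
  adj_irr : irreflexive adj;
  tree_connected : forall x y : vertex, connect adj x y;
  tree_acyclic : forall c : seq vertex, ucycle adj c -> (size c <= 2)%N }.

Section Paths.
Variable S : tree.

(* As in [path], the sequence p omits the start vertex x. *)
Definition simple_path (x y : S) (p : seq S) : bool :=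
  [&& path (@adj S) x p, last x p == y & uniq (x :: p)].

Lemma simple_path_ex (x y : S) : exists p, simple_path x y p.
Proof.
have /connectP[p xp ->] := tree_connected x y.
have [q xq uq _] := shortenP xp.
by exists q; rewrite /simple_path xq eqxx.
Qed.

Lemma simple_path_uniq (x y : S) (p q : seq S) :
  simple_path x y p -> simple_path x y q -> p = q.
Proof.
elim: p x q => [|a p IHp] x q.
  case: q => [//|b q] /and3P[_ /eqP /= <- _] /and3P[_ /eqP lq /= /andP[xq _]].
  by rewrite -lq /= mem_last in xq.
move=> Pp; case: q => [|b q Pq].
  move: Pp => /and3P[_ /eqP lp /andP[xp _]] /and3P[_ /eqP /= xy _].
  by rewrite xy -lp /= mem_last in xp.
have [eab|nab] := eqVneq a b.
  subst b; congr (_ :: _); apply: (IHp a).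
    by case/and3P: Pp => /= /andP[_ ap] lp /andP[_ up]; apply/and3P.
  by case/and3P: Pq => /= /andP[_ ap] lp /andP[_ up]; apply/and3P.
exfalso; move: Pp Pq => /and3P[xap /eqP lp uxp] /and3P[xbq /eqP lq uxq].
have hp : has (mem (b :: q)) (a :: p).
  by apply/hasP; exists y; [rewrite -lp /= mem_last|rewrite -lq inE /= mem_last].
have [z [p1 [p2 [zq np1 Ep]]]] : exists z p1 p2,
    [/\ z \in b :: q, ~~ has (mem (b :: q)) p1 & a :: p = rcons p1 z ++ p2].
  by case: (split_find hp) => z p1 p2 zq np1; exists z, p1, p2.
have [q1 [q2 Eq]] : exists q1 q2, b :: q = q1 ++ z :: q2.
  by case: (path.splitPr zq) => q1 q2; exists q1, q2.
rewrite Ep in xap uxp; rewrite Eq in xbq uxq.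
have cyc : ucycle (@adj S) (rcons (x :: p1) z ++ rev q1).
  rewrite /ucycle; apply/andP; split.
    rewrite /= rcons_cat cat_path last_rcons.
    move: xap; rewrite cat_path => /andP[-> _] /=.
    move: xbq; rewrite -cat_rcons cat_path => /andP[xq _].
    have := rev_path (@adj S) x (rcons q1 z).
    rewrite last_rcons belast_rcons rev_cons => ->.
    by rewrite (eq_path (e' := @adj S)) // => u v; rewrite adj_sym.
  move: uxp uxq; rewrite -!cat_cons !cat_uniq => /and3P[u1 _ _].
  move=> /and3P[/= /andP[xq uq] nq _].
  have {nq}zq1 : z \notin q1.
    by move: nq; rewrite /= !inE !negb_or => /andP[/andP[]].
  move: u1 => /= ->; rewrite rev_uniq uq andbT.
  apply/hasPn => u /=; rewrite mem_rev => uq1.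
  rewrite !inE mem_rcons !inE !negb_or; apply/and3P; split.
  - by apply: contraNneq xq => <-.
  - by apply: contraTneq uq1 => ->.
  - apply: contra np1 => up1; apply/hasP; exists u => //=.
    by rewrite Eq mem_cat uq1.
have := tree_acyclic cyc; rewrite size_cat size_rev size_rcons /=.
rewrite !addSn !ltnS leqn0 addn_eq0 !size_eq0 => /andP[/eqP p10 /eqP q10].
move: Ep Eq nab; rewrite p10 q10 /= => -[-> _] -[-> _].
by rewrite eqxx.
Qed.

Definition tree_path (x y : S) : seq S := xchoose (simple_path_ex x y).

End Paths.

Section Embeddings.
Variable R : realType.

(* The library norm `|x| on 'rV[R]_2 is the maximum norm. *)
Definition l1_norm (x : 'rV[R]_2) : R := \sum_(i < 2) `|x 0 i|.

(* Positions and length restrictions are total functions on the vertices;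
   only their values on [terminal] matter. *)
Record instance := Instance {
  shape :> tree;
  terminal : {set shape};
  root : shape;
  root_terminal : root \in terminal;
  pos : shape -> 'rV[R]_2;
  pos_root : pos root = 0;
  len : shape -> R;
  len_ge0 : forall t, t \in terminal -> 0 <= len t }.

Variable I : instance.
Implicit Type f : I -> 'rV[R]_2.

Definition embedding f : Prop := forall t, t \in terminal I -> f t = pos t.

(* [zip (root I :: s) s] lists the consecutive pairs of the path root I :: s. *)
Definition dist f (t : I) : R :=
  let s := tree_path (root I) t in
  \sum_(u <- zip (root I :: s) s) l1_norm (f u.1 - f u.2).

(* Comparing ranks keeps exactly one orientation of each edge. *)
Definition cost f : R :=
  \sum_(v : I) \sum_(w : I | adj v w && (enum_rank v < enum_rank w)%N)
    l1_norm (f v - f w).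

Definition feasible f : Prop :=
  embedding f /\ forall t, t \in terminal I -> dist f t <= len t.

Definition half_integral f : Prop :=
  forall (v : I) (i : 'I_2), exists k : int, f v 0 i = k%:~R / 2.

End Embeddings.

(* Main.v *)
(** Let A_i(v) be the total variation of coordinate i of pi along the path from
    the root to v. The four potentials A_i + x_i and A_i - x_i are
    nondecreasing away from the root, and they encode everything: x_i is half
    the difference of the two potentials of coordinate i, the distance to v is
    half the sum of all four, and the cost is a linear function of them. At a
    terminal t, the difference A_i + x_i - (A_i - x_i) = 2 x_i is a prescribed
    integer, so the length bound reduces to
      (A_0 - x_0) + (A_1 - x_1) <= l_t - x_0 - x_1,
    again with an integral right-hand side. After negating the potentials of
    coordinate 1, all constraints are difference constraints with integral
    constants, which any rounding z |-> floor (z + th) preserves. For th uniform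
    in [0, 1) the expectation of floor (z + th) is z, so some th does not
    increase the cost. The rounded potentials are integers, hence the new x_i
    are half-integral, and they move by at most 1/2. *)

Require Import Defs.
From HB Require Import structures.
From mathcomp Require Import all_boot all_order all_algebra.
From mathcomp Require Import reals normedtype.
From mathcomp Require Import ring lra.
Set Implicit Arguments.
Unset Strict Implicit.
Unset Printing Implicit Defensive.
Import Order.TTheory GRing.Theory Num.Theory.
Local Open Scope ring_scope.

(** * Averaging over thresholds *)

(* The right-hand side is the integral over t in ]0, B] of the sum on the left;
   the induction peels off the smallest value of f inside ]0, B[. *)
Lemma threshold_averaging (R : realFieldType) (J : finType) (c f : J -> R)
    (B : R) :
  0 < B -> (forall j, 0 <= f j <= B) ->
  exists2 t, 0 < t <= B & B * (\sum_(j | t <= f j) c j) <= \sum_j c j * f j.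
Proof.
have [n] := ubnP #|[pred j | 0 < f j < B]|.
elim: n f B => // n IHn f B card_lt B0 fB.
have [/existsP[j1 j1P]|/existsPn noneP] := boolP [exists j, 0 < f j < B];
  last first.
  exists B; first by rewrite B0 lexx.
  rewrite mulr_sumr (big_mkcond (fun j => B <= f j)); apply: ler_sum => j _.
  have := noneP j; have /andP[f0 f1] := fB j.
  case: ifP => [Bf Bn|/negbT].
    by rewrite (_ : f j = B) 1?mulrC //; lra.
  rewrite -ltNge => fltB; rewrite fltB andbT -leNgt => fle0.
  by rewrite (_ : f j = 0) ?mulr0 //; apply: le_anti; rewrite fle0.
have [j0] := arg_minP (P := fun j => 0 < f j < B) f j1P.
move=> /andP[m0 mB] minP; set m := f j0 in m0 mB minP.
(* The values 0 stay at 0, [B] goes to [B - m] and [m] to 0; hence [j0] leaves the set that is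
   counted and nothing enters it. *)
pose g j := Num.max (f j - m) 0.
have gpos t j : 0 < t -> (t <= g j) = (t + m <= f j).
  move=> t0; rewrite /g le_max; apply/orP/idP => [[]|]; lra.
have [||j|t /andP[t0 tB] tP] := IHn g (B - m).
- rewrite ltnS in card_lt; apply: leq_trans card_lt; apply: proper_card.
  apply/properP; split; last first.
    by exists j0; rewrite !inE ?m0 ?mB // /g subrr maxxx ltxx.
  apply/subsetP => j; rewrite !inE /g; case: (leP (f j - m) 0); lra.
- by lra.
- by rewrite /g; have /andP[f0 f1] := fB j; case: (leP (f j - m) 0); lra.
have split_sum : \sum_j c j * f j =
    m * (\sum_(j | m <= f j) c j) + \sum_j c j * g j.
  rewrite mulr_sumr (big_mkcond (fun j => m <= f j)) -big_split /=.
  apply: eq_bigr => j _; rewrite /g; have /andP[f0 f1] := fB j.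
  case: ifP => [mf|/negbT]; first by rewrite max_l; [ring|lra].
  rewrite -ltNge => fm; rewrite max_r; last lra.
  have := minP j; have [->|fn0 jP] := eqVneq (f j) 0; first by lra.
  suff : m <= f j by lra.
  by apply: jP; rewrite lt_neqAle eq_sym fn0 f0 /=; lra.
rewrite (eq_bigl (fun j => t + m <= f j)) in tP; last by move=> j; rewrite gpos.
set S1 := \sum_(j | m <= f j) c j in split_sum.
set S2 := \sum_(j | t + m <= f j) c j in tP.
(* The right-hand side is at least [m * S1 + (B - m) * S2], so the threshold with the smaller of the
   two sums works. *)
have [S12|S21] := leP S1 S2.
  exists m; first by lra.
  rewrite -/S1 split_sum; apply: le_trans (lerD (lexx _) tP).
  by nra.
exists (t + m); first by lra.
rewrite -/S2 split_sum; apply: le_trans (lerD (lexx _) tP); nra.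
Qed.

(** * Floors with a shift *)

Definition shift_floor (R : realType) (th z : R) : R :=
  (Num.floor (z + th))%:~R.

Lemma shift_floor_itv (R : realType) (th z : R) :
  shift_floor th z <= z + th < shift_floor th z + 1.
Proof. by have := floor_itv (z + th); rewrite intrD. Qed.

Lemma shift_floor_le (R : realType) (th x y : R) :
  x <= y -> shift_floor th x <= shift_floor th y.
Proof. by move=> xy; rewrite ler_int; apply: le_floor; rewrite lerD2r. Qed.

Lemma shift_floorD (R : realType) (th x y : R) : y \is a Num.int ->
  shift_floor th (x + y) = shift_floor th x + y.
Proof.
by move=> yint; rewrite /shift_floor addrAC floorDrz // intrD (floorK yint).
Qed.

Lemma shift_floor0 (R : realType) (th : R) :
  0 <= th < 1 -> shift_floor th 0 = 0.
Proof. by move=> ?; rewrite /shift_floor add0r (@floor_def _ _ 0) ?add0r. Qed.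

(** Thresholds are averaged over the fractional parts [f j], with [B = 1]. The shift [1 - t] rounds
    [z j] up exactly when [t <= f j], and [0 < t <= 1] puts it in [0, 1). *)
Lemma shift_floor_averaging (R : realType) (J : finType) (c z : J -> R) :
  exists2 th, 0 <= th < 1 &
    \sum_j c j * shift_floor th (z j) <= \sum_j c j * z j.
Proof.
pose f j := z j - (Num.floor (z j))%:~R.
have fb j : 0 <= f j <= 1.
  by have := floor_itv (z j); rewrite intrD /f; lra.
have [t /andP[t0 t1]] := threshold_averaging c ltr01 fb.
rewrite mul1r => tP.
exists (1 - t); first by lra.
have floorE j : shift_floor (1 - t) (z j) =
    (Num.floor (z j))%:~R + (t <= f j)%R%:R.
  have zb := floor_itv (z j); rewrite intrD in zb.
  rewrite /f; case: (leP t) => tf /=.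
    rewrite /shift_floor (@floor_def _ _ (Num.floor (z j) + 1)) ?intrD //.
    by apply/andP; split; lra.
  rewrite /shift_floor (@floor_def _ _ (Num.floor (z j))) ?addr0 // intrD.
  by apply/andP; split; lra.
rewrite (eq_bigr (fun j => c j * (Num.floor (z j))%:~R +
  c j * (t <= f j)%R%:R)) => [|j _]; last by rewrite floorE mulrDr.
rewrite [leRHS](eq_bigr (fun j => c j * (Num.floor (z j))%:~R + c j * f j));
  last by move=> j _; rewrite /f; ring.
rewrite !big_split lerD2l /=; apply: le_trans tP.
rewrite [leRHS]big_mkcond /=; apply: ler_sum => j _.
by case: (leP t); rewrite ?mulr1 ?mulr0.
Qed.

(** * Paths from the root of a tree *)

Lemma tree_pathP (S : tree) (x y : S) : simple_path x y (tree_path x y).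
Proof. exact: xchooseP. Qed.

Lemma tree_path_eq (S : tree) (x y : S) (p : seq S) :
  simple_path x y p -> tree_path x y = p.
Proof. exact: simple_path_uniq (tree_pathP _ _). Qed.

Definition child (S : tree) (r v w : S) : bool :=
  tree_path r w == rcons (tree_path r v) w.

Lemma tree_path_nil (S : tree) (r : S) : tree_path r r = [::].
Proof. by apply: tree_path_eq; rewrite /simple_path /= eqxx. Qed.

Lemma last_tree_path (S : tree) (x y : S) : last x (tree_path x y) = y.
Proof. by case/and3P: (tree_pathP x y) => _ /eqP. Qed.

Lemma tree_path_prefix (S : tree) (r v : S) (p q : seq S) :
  tree_path r v = p ++ q -> tree_path r (last r p) = p.
Proof.
move=> E; apply: tree_path_eq; have := tree_pathP r v; rewrite E.
rewrite /simple_path cat_path -cat_cons cat_uniq.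
by case/and3P => /andP[-> _] _ /and3P[-> _ _]; rewrite eqxx.
Qed.

Lemma tree_path_suffix (S : tree) (r v : S) (p q : seq S) :
  tree_path r v = p ++ q -> tree_path (last r p) v = q.
Proof.
move=> E; apply: tree_path_eq; have := tree_pathP r v; rewrite E.
rewrite /simple_path cat_path last_cat => /and3P[/andP[_ ->] ->].
by rewrite -cat_cons lastI cat_rcons cat_uniq => /and3P[_ _ ->].
Qed.

Lemma tree_path_adj (S : tree) (x y : S) : adj x y -> tree_path x y = [:: y].
Proof.
move=> xy; apply: tree_path_eq; rewrite /simple_path /= xy eqxx inE andbT.
by case: eqP xy => // ->; rewrite adj_irr.
Qed.

(** If [w] is off the path to [v], appending it gives the path to [w]. Otherwise the part of that
    path after [w] is, by uniqueness, the single edge to [v]. *)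
Lemma adj_child (S : tree) (r v w : S) :
  adj v w -> child r v w || child r w v.
Proof.
move=> vw.
have [wp|wNp] := boolP (w \in r :: tree_path r v).
  apply/orP; right; apply/eqP.
  have [p [q [E lp]]] : exists p q, tree_path r v = p ++ q /\ last r p = w.
    case: (splitPl wp) => p q lp; by exists p, q.
  have := tree_path_prefix E; have := tree_path_suffix E.
  rewrite lp tree_path_adj => [qE ->|]; last by rewrite adj_sym.
  by rewrite E -qE cats1.
apply/orP; left; apply/eqP; apply: tree_path_eq.
case/and3P: (tree_pathP r v) => pv /eqP lv uv.
rewrite /simple_path rcons_path last_rcons pv lv vw eqxx.
by rewrite -rcons_cons rcons_uniq wNp.
Qed.

Lemma tree_ind_from (S : tree) (r : S) (P : S -> Prop) :
  P r -> (forall v w, child r v w -> P v -> P w) -> forall v, P v.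
Proof.
move=> Pr Pchild v; have [n] := ubnP (size (tree_path r v)).
elim: n v => // n IHn v.
case/lastP E: (tree_path r v) => [|p u].
  by have := last_tree_path r v; rewrite E /= => <-.
have uv : u = v by rewrite -(last_tree_path r v) E last_rcons.
rewrite size_rcons ltnS => pn; rewrite uv -cats1 in E.
have pE := tree_path_prefix E.
apply: (Pchild (last r p)); first by rewrite /child pE E cats1.
by apply: IHn; rewrite pE.
Qed.

(** * Sums along root paths and summation by parts *)

Definition path_sum (R : realType) (S : tree) (r : S) (F : S * S -> R)
    (v : S) : R :=
  \sum_(u <- zip (r :: tree_path r v) (tree_path r v)) F u.

Lemma path_sum_root (R : realType) (S : tree) (r : S) (F : S * S -> R) :
  path_sum r F r = 0.
Proof. by rewrite /path_sum tree_path_nil big_nil. Qed.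

Lemma path_sum_child (R : realType) (S : tree) (r : S) (F : S * S -> R)
    (v w : S) :
  child r v w -> path_sum r F w = path_sum r F v + F (v, w).
Proof.
have zipE x (s : seq S) : zip (x :: rcons s w) (rcons s w) =
    rcons (zip (x :: s) s) (last x s, w).
  by elim: s x => //= a s IHs x; rewrite IHs.
move/eqP; rewrite /path_sum => ->.
by rewrite zipE last_tree_path -cats1 big_cat big_seq1.
Qed.

(** Collects the weight entering each vertex minus the weight leaving it. As [c] does not depend on
    [H], the same coefficients serve before and after rounding. *)
Lemma sum_by_parts (R : realType) (V : finType) (P : V -> V -> bool)
    (s : V -> V -> R) :
  exists c : V -> R, forall H : V -> R,
    \sum_v \sum_(w | P v w) s v w * (H w - H v) = \sum_v c v * H v.
Proof.
exists (fun v => \sum_(u | P u v) s u v - \sum_(w | P v w) s v w) => H.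
under eq_bigr do under eq_bigr do rewrite mulrBr.
under eq_bigr do rewrite sumrB.
rewrite sumrB (exchange_big_dep xpredT) //= -sumrB.
by apply: eq_bigr => v _; rewrite mulrBl !mulr_suml.
Qed.

(** * Signed rounding *)

(* The Boolean s selects the potentials that are negated before rounding. *)
Definition sfloor (R : realType) (s : bool) (th x : R) : R :=
  if s then - shift_floor th (- x) else shift_floor th x.

Lemma sfloor_le (R : realType) (s : bool) (th x y : R) :
  x <= y -> sfloor s th x <= sfloor s th y.
Proof.
by case: s => xy; rewrite /sfloor ?lerN2 shift_floor_le // lerN2.
Qed.

Lemma sfloorD (R : realType) (s : bool) (th x y : R) : y \is a Num.int ->
  sfloor s th (x + y) = sfloor s th x + y.
Proof.
move=> yint; case: s; rewrite /sfloor ?opprD shift_floorD ?rpredN //.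
by rewrite opprD opprK.
Qed.

Lemma sfloor0 (R : realType) (s : bool) (th : R) :
  0 <= th < 1 -> sfloor s th 0 = 0.
Proof. by move=> th01; case: s; rewrite /sfloor ?oppr0 shift_floor0 ?oppr0. Qed.

(** For a fixed sign and shift, all rounding errors lie in one half-open interval of length 1. *)
Lemma sfloor_dist (R : realType) (s : bool) (th x y : R) :
  `|(x - y) - (sfloor s th x - sfloor s th y)| <= 1.
Proof.
rewrite ler_norml; case: s; rewrite /sfloor.
  have := shift_floor_itv th (- x); have := shift_floor_itv th (- y); lra.
have := shift_floor_itv th x; have := shift_floor_itv th y; lra.
Qed.

Lemma sfloor_int (R : realType) (s : bool) (th x : R) :
  sfloor s th x \is a Num.int.
Proof. by case: s; rewrite /sfloor ?rpredN /shift_floor rpred_int. Qed.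

(** The signs move into the coefficients and the arguments, where they cancel in each product. *)
Lemma sfloor_averaging (R : realType) (J : finType) (s : J -> bool)
    (c z : J -> R) :
  exists2 th, 0 <= th < 1 &
    \sum_j c j * sfloor (s j) th (z j) <= \sum_j c j * z j.
Proof.
have [th th01 thP] := shift_floor_averaging
  (fun j => if s j then - c j else c j) (fun j => if s j then - z j else z j).
exists th => //; move: thP; congr (_ <= _); apply: eq_bigr => j _.
  by rewrite /sfloor; case: (s j); rewrite ?mulrNN ?mulrN ?mulNr.
by case: (s j); rewrite ?mulrNN.
Qed.

(** * Norms in the plane *)

Lemma l1_normB (R : realType) (x y : 'rV[R]_2) :
  l1_norm (x - y) = \sum_i `|x 0 i - y 0 i|.
Proof. by apply: eq_bigr => i _; rewrite !mxE. Qed.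

Lemma l1_norm_sym (R : realType) (x y : 'rV[R]_2) :
  l1_norm (x - y) = l1_norm (y - x).
Proof. by rewrite !l1_normB; apply: eq_bigr => i _; rewrite distrC. Qed.

Lemma rV_norm_le (R : realType) (n : nat) (x : 'rV[R]_n) (b : R) :
  0 <= b -> (forall i, `|x 0 i| <= b) -> `|x| <= b.
Proof.
move=> b0 xb; rewrite [`|x|]mx_normrE; apply: bigmax_le => // -[i j] _ /=.
by rewrite ord1.
Qed.

Lemma dist_path_sum (R : realType) (I : instance R) (f : I -> 'rV[R]_2)
    (v : I) :
  dist f v = path_sum (Defs.root I) (fun u => l1_norm (f u.1 - f u.2)) v.
Proof. by []. Qed.

Theorem theorem1 (R : realType) (I : instance R)
  (pos_int : forall t : I, t \in terminal I ->
     forall i : 'I_2, pos t 0 i \is a Num.int)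
  (len_int : forall t : I, t \in terminal I -> len t \is a Num.int)
  (pi : I -> 'rV[R]_2) (pi_feasible : feasible pi) :
  exists sigma : I -> 'rV[R]_2,
    [/\ feasible sigma, half_integral sigma,
        \big[Num.max/0]_(v : I) `|pi v - sigma v| <= 1 / 2 &
        cost sigma <= cost pi].
Proof.
have [pi_emb pi_len] := pi_feasible.
pose r := Defs.root I.
pose A (i : 'I_2) := path_sum r (fun u => `|pi u.1 0 i - pi u.2 0 i|).
(* [z i false] and [z i true] are the potentials A_i + x_i and A_i - x_i. *)
pose z (i : 'I_2) (b : bool) v := A i v + (-1) ^+ b * pi v 0 i.
(* The cost orients edges by rank; this sign turns them away from the root. *)
pose s v w : R := if child r v w then 1 else -1.
pose edge (v w : I) := adj v w && (enum_rank v < enum_rank w)%N.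
have [c cP] := sum_by_parts edge s.
(* A single shift must serve all vertices, coordinates and potentials, so the average runs over
   their product. *)
have [th th01 thP] := sfloor_averaging
  (J := (I * ('I_2 * bool))%type) (fun j => odd j.2.1) (fun j => c j.1)
  (fun j => z j.2.1 j.2.2 j.1).
pose q (i : 'I_2) b v := sfloor (odd i) th (z i b v).
(* The rounded counterpart of [A i v]. It only bounds the variation of [sigma] from above, which
   suffices for both lengths and cost. *)
pose B i v := (q i false v + q i true v) / 2.
pose sigma v : 'rV[R]_2 := \row_i ((q i false v - q i true v) / 2).
have pi_r : pi r = 0 by rewrite pi_emb ?pos_root // root_terminal.
have z_r i b : z i b r = 0.
  by rewrite /z /A path_sum_root pi_r mxE mulr0 addr0.
have B_r i : B i r = 0 by rewrite /B /q !z_r sfloor0 // addr0 mul0r.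
have z_child i b v w : child r v w -> z i b v <= z i b w.
  move=> vw; rewrite /z /A (path_sum_child _ vw) /=.
  have := ler_norm (pi v 0 i - pi w 0 i).
  have := ler_norm (pi w 0 i - pi v 0 i); rewrite [`|pi w _ _ - _|]distrC.
  case: b; rewrite ?expr1 ?expr0; lra.
have sigma_child i v w : child r v w ->
    `|sigma v 0 i - sigma w 0 i| <= B i w - B i v.
  move=> vw; rewrite !mxE /B ler_norml.
  have := sfloor_le (odd i) th (z_child i false _ _ vw).
  have := sfloor_le (odd i) th (z_child i true _ _ vw).
  rewrite -!/(q _ _ _); lra.
have dist_pi v : dist pi v = \sum_i A i v.
  rewrite dist_path_sum; elim/(@tree_ind_from _ r): v => [|v w vw IHv].
    by rewrite path_sum_root big1 // => i _; rewrite /A path_sum_root.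
  rewrite (path_sum_child _ vw) IHv l1_normB -big_split /=.
  by apply: eq_bigr => i _; rewrite /A (path_sum_child _ vw).
have dist_sigma v : dist sigma v <= \sum_i B i v.
  rewrite dist_path_sum; elim/(@tree_ind_from _ r): v => [|v w vw IHv].
    by rewrite path_sum_root big1.
  rewrite (path_sum_child _ vw) l1_normB -lerBrDr.
  apply: (le_trans IHv); rewrite -sumrB; apply: ler_sum => i _.
  by have := sigma_child i _ _ vw => /=; lra.
have q_diff t i : t \in terminal I -> q i false t = q i true t + pos t 0 i *+ 2.
  move=> tT; rewrite /q -sfloorD ?rpredMn ?pos_int // /z pi_emb //.
  by congr (sfloor _ _ _); rewrite expr0 expr1; ring.
exists sigma; split.
- split=> [t tT|t tT].
    by apply/rowP => i; rewrite mxE q_diff // -mulr_natr; field.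
  apply: le_trans (dist_sigma t) _.
  have := pi_len t tT; rewrite dist_pi !big_ord_recl !big_ord0 !addr0.
  set i0 : 'I_2 := ord0; set i1 : 'I_2 := lift ord0 ord0 => A_len.
  rewrite /B !q_diff //.
  have mint : len t - pos t 0 i0 - pos t 0 i1 \is a Num.int.
    by rewrite !rpredB ?len_int ?pos_int.
  (* Coordinate 1 is rounded after negation, so both sides here pass through the same monotone
     [shift_floor th]. *)
  have z_le : z i0 true t <= - z i1 true t + (len t - pos t 0 i0 - pos t 0 i1).
    move: A_len; rewrite /z !pi_emb // expr1.
    move: (A i0 t) (A i1 t) (pos t 0 i0) (pos t 0 i1) (len t).
    by clear => *; lra.
  have := shift_floor_le th z_le; rewrite (shift_floorD th (- _)) //.
  have -> : shift_floor th (z i0 true t) = q i0 true t by [].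
  have -> : shift_floor th (- z i1 true t) = - q i1 true t by rewrite opprK.
  move: (q i0 true t) (q i1 true t) (pos t 0 i0) (pos t 0 i1) (len t).
  by clear => *; lra.
- move=> v i.
  have /intrP[k kE] : q i false v - q i true v \is a Num.int.
    by rewrite rpredB ?sfloor_int.
  by exists k; rewrite mxE kE.
- apply: bigmax_le => [|v _]; first by lra.
  apply: rV_norm_le => [|i]; first by lra.
  rewrite !mxE.
  have := sfloor_dist (odd i) th (z i false v) (z i true v).
  rewrite -!/(q _ _ _) !ler_norml /z expr0 expr1; lra.
have cost_pi : cost pi = \sum_v c v * \sum_i A i v.
  rewrite -cP; apply: eq_bigr => v _; apply: eq_bigr => w /andP[vw _].
  have child_pi a b : child r a b ->
      \sum_i A i b - \sum_i A i a = l1_norm (pi a - pi b).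
    move=> ab; rewrite l1_normB -sumrB; apply: eq_bigr => i _.
    by rewrite /A (path_sum_child _ ab) addrC addKr.
  rewrite /s; case: ifP => [vc|vNc]; first by rewrite child_pi // mul1r.
  have := adj_child r vw; rewrite vNc /= => wc.
  by rewrite mulN1r opprB child_pi // l1_norm_sym.
have cost_sigma : cost sigma <= \sum_v c v * \sum_i B i v.
  rewrite -cP; apply: ler_sum => v _; apply: ler_sum => w /andP[vw _].
  have child_sigma a b : child r a b ->
      l1_norm (sigma a - sigma b) <= \sum_i B i b - \sum_i B i a.
    move=> ab; rewrite l1_normB -sumrB; apply: ler_sum => i _.
    exact: sigma_child.
  rewrite /s; case: ifP => [vc|vNc]; first by rewrite mul1r child_sigma.
  have := adj_child r vw; rewrite vNc /= => wc.
  by rewrite mulN1r opprB l1_norm_sym child_sigma.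
(* Flattens the half-sums of potentials to the index set over which [th] was averaged. *)
have sumE (F : 'I_2 -> bool -> I -> R) :
    \sum_v c v * \sum_i (F i false v + F i true v) / 2 =
    (\sum_j c j.1 * F j.2.1 j.2.2 j.1) / 2.
  rewrite -(pair_bigA _ (fun v ib => c v * F ib.1 ib.2 v)) /= mulr_suml.
  apply: eq_bigr => v _.
  rewrite -(pair_bigA _ (fun i b => c v * F i b v)) /= mulr_sumr mulr_suml.
  by apply: eq_bigr => i _; rewrite big_bool /=; ring.
apply: le_trans cost_sigma _; rewrite cost_pi sumE.
have -> : \sum_v c v * \sum_i A i v =
    \sum_v c v * \sum_i (z i false v + z i true v) / 2.
  apply: eq_bigr => v _; congr (_ * _); apply: eq_bigr => i _.
  by rewrite /z expr0 expr1; field.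
by rewrite sumE ler_pM2r // invr_gt0.
Qed.
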